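(* Let $\nu\in\mathcal M^1$ be a probability measure and assume $\varphi'(\infty)=\infty$. For $\tau\in\mathbb R$ let $\mathcal B_{\varphi,\nu}(\tau)=\{\mu\in\mathcal M:D_\varphi(\mu\|\nu)\le\tau\}$. Then for every $\tau\in\mathbb R$ the sets $\mathcal B_{\varphi,\nu}(\tau)$ and $\mathcal M^1\cap\mathcal B_{\varphi,\nu}(\tau)$ are compact in the initial topology induced by the maps $\mu\mapsto\int g\,d\mu$, where $g$ ranges over all strongly $(\varphi,\nu)$-subexponential functions.
   Context: $(\Omega,\mathcal F)$ is a measurable space with $\{\emptyset,\Omega\}\subsetneq\mathcal F$; $\mathcal M,\mathcal M^+,\mathcal M^1$ are the sets of finite signed measures, finite non-negative measures and probability measures on it. $L^0(\nu)$ is the space of real measurable functions modulo $\nu$-a.e. equality. Standing assumptions on $\varphi$: $\varphi:\mathbb R\to[0,+\infty]$ is convex, lower semicontinuous, $\varphi(1)=0$, $\varphi(x)=+\infty$ for $x<0$, and $\operatorname{dom}\varphi$ contains a neighborhood of $1$. $\varphi'(\pm\infty)=\lim_{x\to\pm\infty}\varphi(x)/x$. Set $\psi(x)=\varphi(x+1)$; $f^\star(y)=\sup_x\{xy-f(x)\}$ denotes the convex conjugate. For $\mu\in\mathcal M$, $\nu\in\mathcal M^+$ with Lebesgue decomposition $\mu=\mu_c+\mu_s$ ($\mu_c\ll\nu$, $\mu_s\perp\nu$) and Hahn–Jordan decomposition $\mu_s=\mu_s^+-\mu_s^-$, $D_\varphi(\mu\|\nu)=\int\varphi(\frac{d\mu_c}{d\nu})d\nu+\mu_s^+(\Omega)\varphi'(\infty)-\mu_s^-(\Omega)\varphi'(-\infty)$,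 with $0\cdot(\pm\infty)=0$. (When $\varphi'(\infty)=\infty$, $D_\varphi(\mu\|\nu)<\infty$ forces $\mu\ll\nu$ and $\mu\geq 0$.) For $g\in L^0(\nu)$, $K_{g,\nu}(t)=\inf\{\int\psi^\star(tg+\lambda)\,d\nu:\lambda\in\mathbb R,\ \lambda+\operatorname{ess\,sup}_\nu(tg)\le\varphi'(\infty)\}$ for $t\in\mathbb R$ (when $\varphi'(\infty)=\infty$ the constraint on $\lambda$ is void). $g\in L^0(\nu)$ is strongly $(\varphi,\nu)$-subexponential if $K_{g,\nu}(t)<\infty$ for all $t\in\mathbb R$; every such $g$ is $\mu$-integrable for all $\mu\in\mathcal B_{\varphi,\nu}(\tau)$. *)

(* Defs.v *)
From HB Require Import structures.
From mathcomp Require Import all_boot all_order all_algebra.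
From mathcomp Require Import all_classical all_reals all_analysis.
From mathcomp Require Import ess_sup_inf.

Set Implicit Arguments.
Unset Strict Implicit.
Unset Printing Implicit Defensive.

Import Order.TTheory GRing.Theory Num.Theory.
Import numFieldNormedType.Exports.

Local Open Scope classical_set_scope.
Local Open Scope ring_scope.
Local Open Scope ereal_scope.
Local Open Scope charge_scope.

Record divergence_function (R : realType) (phi : R -> \bar R) : Prop := {
  divergence_ge0 : forall x, 0 <= phi x ;
  divergence_convex : forall (x y t : R), (0 <= t <= 1)%R ->
    phi (t * x + (1 - t) * y)%R <= t%:E * phi x + (1 - t)%:E * phi y ;
  divergence_lsc : lower_semicontinuous phi ;
  divergence_at1 : phi 1%R = 0 ;
  divergence_lt0 : forall x : R, (x < 0)%R -> phi x = +oo ;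
  divergence_dom : \forall x \near (1%R : R), phi x < +oo
}.

Definition slope_pinfty (R : realType) (phi : R -> \bar R) : \bar R :=
  lim (phi x * (x^-1)%:E @[x --> +oo%R]).

Definition slope_ninfty (R : realType) (phi : R -> \bar R) : \bar R :=
  lim (phi x * (x^-1)%:E @[x --> -oo%R]).

Definition convex_conjugate (R : realType) (f : R -> \bar R) (y : R) : \bar R :=
  ereal_sup [set (x * y)%:E - f x | x in [set: R]].

(* Finite signed measures are the library's charges. A charge also carries
   irrelevant values on non-measurable sets, so that several charges may
   represent the same signed measure; everything below depends only on the
   values on measurable sets, and such charges are topologically
   indistinguishable for the initial topology defined at the end. *)

Section signed_measures.
Context d (T : measurableType d) (R : realType).
Implicit Types (mu : {charge set T -> \bar R}).

Definition hahn_pos mu : set T := sval (cid (Hahn_decomposition mu)).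

Definition hahn_neg mu : set T :=
  sval (cid (svalP (cid (Hahn_decomposition mu)))).

Definition hahn_decompositionP mu :
    hahn_decomposition mu (hahn_pos mu) (hahn_neg mu) :=
  svalP (cid (svalP (cid (Hahn_decomposition mu)))).

Definition positive_part mu : {finite_measure set T -> \bar R} :=
  jordan_pos (hahn_decompositionP mu).

Definition negative_part mu : {finite_measure set T -> \bar R} :=
  jordan_neg (hahn_decompositionP mu).

(* Does not depend on the chosen Hahn decomposition. The value is meaningful when
   g is integrable for both parts of mu. *)
Definition charge_integral mu (g : T -> R) : R :=
  (\int[positive_part mu]_x g x - \int[negative_part mu]_x g x)%R.

Definition probability_charges : set ({charge set T -> \bar R}) :=
  [set mu | (forall A, measurable A -> 0 <= mu A) /\ mu [set: T] = 1].

Definition mutually_singular mu (nu : {measure set T -> \bar R}) :=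
  exists N, [/\ measurable N, nu N = 0 &
    forall A, measurable A -> A `<=` ~` N -> mu A = 0].

Definition lebesgue_decomposition mu (nu : {measure set T -> \bar R})
    (mu_cs : {charge set T -> \bar R} * {charge set T -> \bar R}) :=
  [/\ mu_cs.1 `<< nu, mutually_singular mu_cs.2 nu &
    forall A, measurable A -> mu A = mu_cs.1 A + mu_cs.2 A].

Lemma lebesgue_decomposition_exists mu (nu : {measure set T -> \bar R}) :
  exists mu_cs, lebesgue_decomposition mu nu mu_cs.
Proof.
pose v : {measure set T -> \bar R} :=
  charge_variation (hahn_decompositionP mu).
pose S := [set v A | A in [set A | measurable A /\ nu A = 0]].
have S0 : S != set0 by apply/set0P; exists (v set0); exists set0.
have [u uS ucvg] := ereal_sup_seq S0.
have /choice[A_ A_P] : forall n, exists A,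
    [/\ measurable A, nu A = 0 & v A = u n].
  by move=> n; have [A [mA nA] vA] := uS n; exists A.
pose N := \bigcup_n A_ n.
have mA_ n : measurable (A_ n) by have [] := A_P n.
have mN : measurable N by exact: bigcupT_measurable.
have nuN : nu N = 0.
  have : nu.-negligible N.
    by apply: negligible_bigcup => n; exists (A_ n); have [mA nA _] := A_P n; split.
  by move=> /(negligibleP _ mN).
have supS : ereal_sup S <= v N.
  rewrite -(cvg_lim _ ucvg)//; apply: lime_le; first by apply/cvgP: ucvg.
  apply: nearW => n; have [_ _ <-] := A_P n.
  by apply: le_measure; rewrite ?inE//; exact: bigcup_sup.
exists (crestr0 mu (measurableC mN) : {charge set T -> \bar R},
        crestr0 mu mN : {charge set T -> \bar R}); split => /=.
- apply/null_content_dominatesP => A mA nuA.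
  rewrite /= /crestr0 mem_set// /crestr.
  have mAN : measurable (A `&` ~` N) by apply: measurableI => //; exact: measurableC.
  have vfin B : measurable B -> v B \is a fin_num by move=> mB; exact: fin_num_measure.
  have vU : v (N `|` A `&` ~` N) = v N + v (A `&` ~` N).
    rewrite measureU//; apply/seteqP; split => // x [Nx [_]].
    exact.
  have : v (N `|` A `&` ~` N) <= v N.
    apply: le_trans supS; apply: ereal_sup_ubound.
    exists (N `|` A `&` ~` N) => //; split; first exact: measurableU.
    apply/eqP; rewrite eq_le measure_ge0 andbT.
    apply: (le_trans (measureU2 _ _ _)) => //.
    rewrite [X in X + _]nuN add0e -nuA; apply: le_measure; rewrite ?inE//.
  rewrite vU -[leRHS]adde0 leeD2lE ?vfin// => vle0.
  apply/eqP; rewrite -abse_eq0 eq_le abse_ge0 andbT.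
  exact: le_trans (abse_charge_variation _ _) vle0.
- exists N; split => // A mA AN; rewrite /= /crestr0 mem_set// /crestr.
  by rewrite (_ : A `&` N = set0) ?charge0//; apply/disjoints_subset.
- move=> A mA; rewrite /= /crestr0 !mem_set// /crestr addeC.
  by rewrite -setDE addeC; exact: chargeDI.
Qed.

(* The Lebesgue decomposition is unique on measurable sets. *)
Definition ac_part mu (nu : {measure set T -> \bar R}) :
    {charge set T -> \bar R} :=
  (sval (cid (lebesgue_decomposition_exists mu nu))).1.

Definition sing_part mu (nu : {measure set T -> \bar R}) :
    {charge set T -> \bar R} :=
  (sval (cid (lebesgue_decomposition_exists mu nu))).2.

(* In \bar R, 0 * +oo = 0 * -oo = 0. Radon-Nikodym derivatives take finite
   values, so that fine only changes the type. *)
Definition phi_divergence (phi : R -> \bar R) mu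
    (nu : {finite_measure set T -> \bar R}) : \bar R :=
  \int[nu]_x phi (fine (('d (ac_part mu nu) '/d nu) x))
  + positive_part (sing_part mu nu) [set: T] * slope_pinfty phi
  - negative_part (sing_part mu nu) [set: T] * slope_ninfty phi.

Definition divergence_ball (phi : R -> \bar R)
    (nu : {finite_measure set T -> \bar R}) (tau : R) :
    set ({charge set T -> \bar R}) :=
  [set mu | phi_divergence phi mu nu <= tau%:E].

End signed_measures.

Arguments probability_charges {d} T R.

Section subexponential.
Context d (T : measurableType d) (R : realType).
Variables (phi : R -> \bar R) (nu : {finite_measure set T -> \bar R}).

(* {mfun_ nu, T >-> R} is L^0(nu): real measurable functions modulo nu-a.e.
   equality, coerced to functions by choosing a representative. *)
Definition cumulant (g : {mfun_ nu, T >-> R}) (t : R) : \bar R :=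
  ereal_inf
    [set \int[nu]_x convex_conjugate (fun y => phi (y + 1)%R) (t * g x + l)%R
    | l in [set l : R |
        l%:E + ess_sup nu (fun x => (t * g x)%:E) <= slope_pinfty phi]].

Definition strongly_subexponential (g : {mfun_ nu, T >-> R}) :=
  forall t : R, cumulant g t < +oo.

End subexponential.

HB.instance Definition _ d (T : measurableType d) (R : realType) :=
  gen_eqMixin ({charge set T -> \bar R}).
HB.instance Definition _ d (T : measurableType d) (R : realType) :=
  gen_choiceMixin ({charge set T -> \bar R}).

(* The initial topology for all the maps mu |-> \int g dmu. For phi superlinear
   at +oo, a charge mu of finite divergence satisfies mu << nu, and every
   strongly subexponential g is mu-integrable; hence the topology induced on
   divergence balls depends neither on the representatives of g nor on the
   default values of charge_integral. *)
Definition subexponential_topology d (T : measurableType d) (R : realType)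
    (phi : R -> \bar R) (nu : {finite_measure set T -> \bar R}) :
    topologicalType :=
  sup_topology (fun g : {g : {mfun_ nu, T >-> R} |
                         strongly_subexponential phi g} =>
    Topological.on (initial_topology
      (fun mu : {charge set T -> \bar R} => charge_integral mu (sval g)))).

(* Main.v *)
(* By superlinearity, a charge of finite divergence is f nu with f >= 0 and
   \int phi(f) dnu <= tau. Young's inequality t h f <= phi(f) + phi^*(t h),
   divided by t, makes these densities uniformly integrable against every
   strongly subexponential function. Hence, along an ultrafilter on the ball,
   the limits of the masses of measurable sets form a measure absolutely
   continuous with respect to nu; its density stays in the ball because phi is
   a countable supremum of affine functions, and convergence of masses extends
   to all strongly subexponential integrands by approximation with simple
   functions. *)
Require Import Defs.
From HB Require Import structures.
From mathcomp Require Import all_boot all_order all_algebra.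
From mathcomp Require Import all_classical all_reals all_analysis.
From mathcomp Require Import measurable_realfun.
From mathcomp Require Import lra.

Set Implicit Arguments.
Unset Strict Implicit.
Unset Printing Implicit Defensive.

Import Order.TTheory GRing.Theory Num.Theory.
Import numFieldNormedType.Exports.

Local Open Scope classical_set_scope.
Local Open Scope ring_scope.
Local Open Scope ereal_scope.

(** * Convex conjugates and the Young function *)

(** The topology is generated by functions that may be unbounded, so approximating them by simple
    functions requires an error uniform over the ball, for each function separately. This is why
    every t > 0 must be allowed in Young's inequality: after division by t the contribution tau / t
    is as small as desired. Subexponentiality, however, bounds the conjugate of [psi], at t g rather
    than t |g|, and with a shift that depends on t. These discrepancies are removed once and for
    all, using that [phi] is finite on both sides of 1. Working along an ultrafilter avoids any
    separability assumption, since the masses of all measurable sets converge at once. The price is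
    that such limits are a priori only finitely additive, and that Fatou's lemma is not at hand.
    Countable additivity is recovered from bounds uniform over the ball, and the divergence bound
    from finite maxima of affine functions, whose integrals depend on finitely many masses only. The
    mass of the whole space is one of these limits, which settles the case of probability
    measures. *)

Section conjugate.
Context (R : realType).
Implicit Types (f : R -> \bar R) (x y : R).

Lemma convex_conjugate_ge f x y : (x * y)%:E - f x <= convex_conjugate f y.
Proof. by apply: ereal_sup_ubound; exists x. Qed.

Lemma convex_conjugate_lsc f : lower_semicontinuous (convex_conjugate f).
Proof.
move=> y a /ereal_sup_gt[_ [x _ <-]].
case fx : (f x) => [r| |] //= axr.
- exists [set z | (a < x * z - r)%R].
    have : (x * z - r)%R @[z --> y] --> (x * y - r)%R.
      by apply: cvgB; [exact: cvgMr cvg_id|exact: cvg_cst].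
    by move=> /(_ _ (lt_nbhsr _)); apply; rewrite -lte_fin.
  move=> z /= az; apply: lt_le_trans (convex_conjugate_ge f x z).
  by rewrite fx -EFinB lte_fin.
- exists setT; first exact: filterT.
  move=> z _; apply: lt_le_trans (convex_conjugate_ge f x z).
  by rewrite fx.
Qed.

Lemma convex_conjugate_convex f (s y z : R) : (forall x, 0 <= f x) ->
  (0 <= s <= 1)%R ->
  convex_conjugate f (s * y + (1 - s) * z)%R <=
  s%:E * convex_conjugate f y + (1 - s)%:E * convex_conjugate f z.
Proof.
move=> f0 /andP[s0 s1]; apply: ge_ereal_sup => _ [x _ <-].
have s1' : (0 <= 1 - s)%R by rewrite subr_ge0.
case fx : (f x) (f0 x) => [r| |] // r0.
- apply: (@le_trans _ _ (s%:E * (x * y - r)%:E + (1 - s)%:E * (x * z - r)%:E)).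
    by rewrite -!EFinM -!EFinD lee_fin; lra.
  have [hy hz] := (convex_conjugate_ge f x y, convex_conjugate_ge f x z).
  by rewrite fx in hy hz; apply: leeD; apply: lee_wpmul2l; rewrite ?lee_fin.
- by rewrite /= leNye.
Qed.

End conjugate.

(** Superlinearity of [phi] makes the conjugate finite everywhere, so that [fine] then loses
    nothing. *)
Definition young (R : realType) (phi : R -> \bar R) (y : R) : R :=
  fine (convex_conjugate phi y).

Section young.
Context (R : realType) (phi : R -> \bar R).
Hypotheses (hphi : divergence_function phi) (hslope : slope_pinfty phi = +oo).
Implicit Types (y : R).

Let phi_ge0 (x : R) : 0 <= phi x. Proof. exact: divergence_ge0. Qed.

Lemma slope_pinfty_cvg : phi x * (x^-1)%:E @[x --> +oo%R] --> +oo.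
Proof.
have := hslope; rewrite /slope_pinfty.
(* A [lim] that does not exist takes a default value other than [+oo], so the hypothesis on the
   slope already contains the convergence. *)
have [cv <-//|/dvgP ->] := pselect (cvg (phi x * (x^-1)%:E @[x --> +oo%R])).
by [].
Qed.

Lemma superlinear (a : R) : exists2 m : R, (0 <= m)%R &
  forall x, (m < x)%R -> (a * x)%:E <= phi x.
Proof.
have /cvgeyPge/(_ a)[m [mreal hm]] := slope_pinfty_cvg.
exists (Num.max m 0)%R; first by rewrite le_max lexx orbT.
move=> x; rewrite gt_max => /andP[mx x0].
by rewrite EFinM -lee_pdivlMr// hm.
Qed.

(** In the supremum, negative x contribute [-oo], and x beyond the threshold [m] for the slope |y|
    contribute at most 0. On [0, m] the bound |y| m remains. The point 1, where [phi] vanishes,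
    bounds the supremum from below. *)
Lemma convex_conjugate_fin_num y : convex_conjugate phi y \is a fin_num.
Proof.
rewrite fin_numElt; apply/andP; split.
  apply: lt_le_trans (convex_conjugate_ge phi 1 y).
  by rewrite (divergence_at1 hphi) sube0 ltNyr.
have [m m0 hm] := superlinear `|y|%R.
suff /le_lt_trans : convex_conjugate phi y <= (`|y| * m)%:E.
  by apply; exact: ltry.
apply: ge_ereal_sup => _ [x _ <-].
have yx : (0 <= x -> x * y <= `|y| * x)%R.
  by move=> x0; rewrite mulrC ler_wpM2r// ler_norm.
have [x0|x0] := ltP x 0%R; first by rewrite (divergence_lt0 hphi x0) /= leNye.
have [xm|mx] := leP x m.
  rewrite -[leRHS]sube0 leeB//.
  by rewrite lee_fin (le_trans (yx x0))// ler_wpM2l.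
apply: (@le_trans _ _ 0); last by rewrite lee_fin mulr_ge0.
apply: (@le_trans _ _ ((x * y)%:E - (`|y| * x)%:E)); first by rewrite leeB// hm.
by rewrite -EFinB lee_fin subr_le0 yx.
Qed.

Lemma youngE y : (young phi y)%:E = convex_conjugate phi y.
Proof. by rewrite fineK// convex_conjugate_fin_num. Qed.

Lemma young_inequality (x : R) y : (x * y)%:E <= phi x + (young phi y)%:E.
Proof.
have := convex_conjugate_ge phi x y; rewrite -youngE.
case: (phi x) (phi_ge0 x) => [r| |] // _.
  by rewrite -EFinB -EFinD !lee_fin; lra.
by rewrite addye// leey.
Qed.

Lemma le_young y : (y <= young phi y)%R.
Proof.
have := young_inequality 1 y.
by rewrite (divergence_at1 hphi) add0e lee_fin mul1r.
Qed.

Lemma young_nondecreasing : {homo young phi : y z / (y <= z)%R}.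
Proof.
move=> y z yz; rewrite -lee_fin !youngE; apply: ge_ereal_sup => _ [x _ <-].
have [x0|x0] := ltP x 0%R; first by rewrite (divergence_lt0 hphi x0) /= leNye.
apply: le_trans (convex_conjugate_ge phi x z).
by rewrite leeB// lee_fin ler_wpM2l.
Qed.

Lemma young0 : young phi 0 = 0%R.
Proof.
apply/le_anti; rewrite le_young andbT -lee_fin youngE.
by apply: ge_ereal_sup => _ [x _ <-]; rewrite mulr0 sub0e oppe_le0.
Qed.

Lemma young_ge0 y : (0 <= y)%R -> (0 <= young phi y)%R.
Proof. by move=> y0; rewrite -[leLHS]young0 young_nondecreasing. Qed.

(** Convexity on the segment from 0 to [y], as [young phi] vanishes at 0. It gives the decay of
    [young phi] near 0 without a continuity argument. *)
Lemma young_scale (s y : R) : (0 <= s <= 1)%R ->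
  (young phi (s * y) <= s * young phi y)%R.
Proof.
move=> s01; have := convex_conjugate_convex y 0 phi_ge0 s01.
by rewrite -!youngE young0 mulr0 addr0 mule0 adde0 -EFinM lee_fin.
Qed.

Lemma measurable_young : measurable_fun setT (young phi).
Proof.
apply/measurable_EFinP.
have -> : EFin \o young phi = convex_conjugate phi.
  by apply/funext => y /=; rewrite youngE.
by apply: lower_semicontinuous_measurable; exact: convex_conjugate_lsc.
Qed.

Lemma measurable_divergence : measurable_fun setT phi.
Proof. by apply: lower_semicontinuous_measurable; exact: divergence_lsc. Qed.

(** Cumulants involve the conjugate of [psi], the estimates that of [phi]. They differ by the linear
    term y, which the two inequalities [young_le_psi] and [psi_le_young] express. *)
Let psi (x : R) := phi (x + 1)%R.

Let psi_ge0 (x : R) : 0 <= psi x. Proof. exact: phi_ge0. Qed.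

Let cpsi_ge0 y : 0 <= convex_conjugate psi y.
Proof.
apply: le_trans (convex_conjugate_ge psi 0 y).
by rewrite /psi add0r divergence_at1// mul0r sube0.
Qed.

Let young_le_psi y : (young phi y)%:E <= convex_conjugate psi y + y%:E.
Proof.
rewrite youngE; apply: ge_ereal_sup => _ [x _ <-].
rewrite -leeBlDr//; apply: le_trans (convex_conjugate_ge psi (x - 1)%R y).
rewrite /psi subrK; case: (phi x) (phi_ge0 x) => [r| |]//= _.
by rewrite -!EFinB lee_fin; lra.
Qed.

Let psi_le_young y : convex_conjugate psi y <= (young phi y - y)%:E.
Proof.
apply: ge_ereal_sup => _ [x _ <-]; have := young_inequality (x + 1) y.
rewrite /psi; case: (phi _) (phi_ge0 (x + 1)%R) => [r| |]//=.
  by rewrite -!EFinB -EFinD !lee_fin; lra.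
by rewrite leNye.
Qed.

(* The neighborhood of 1 where phi is finite makes psi^* coercive. *)
Let psi_coercive : exists a c : R, [/\ (0 <= a)%R, (0 <= c)%R &
  forall y, `|y|%:E <= a%:E * convex_conjugate psi y + c%:E].
Proof.
have [e /= e0 he] := divergence_dom hphi.
pose d := (e / 2)%R; have d0 : (0 < d)%R by rewrite divr_gt0.
have de : (d < e)%R by rewrite /d; lra.
have f1 : psi d \is a fin_num.
  rewrite ge0_fin_numE//; apply: he => /=.
  by rewrite /ball_ opprD addrCA subrr addr0 normrN gtr0_norm.
have f2 : psi (- d)%R \is a fin_num.
  rewrite ge0_fin_numE//; apply: he => /=.
  by rewrite /ball_ opprD addrCA subrr addr0 opprK gtr0_norm.
(* Testing the supremum at [d] and at [- d] yields d |y| <= psi^star(y) + c. Both values of [psi]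
   are nonnegative, so their sum bounds each of them. *)
pose c := (fine (psi d) + fine (psi (- d)))%R.
have c1 : (0 <= fine (psi d))%R by exact: fine_ge0.
have c2 : (0 <= fine (psi (- d)%R))%R by exact: fine_ge0.
exists d^-1%R, (d^-1 * c)%R; split.
- by rewrite invr_ge0 ltW.
- by rewrite mulr_ge0// ?invr_ge0 ?(ltW d0)// addr_ge0.
move=> y; have h1 := convex_conjugate_ge psi d y.
have h2 := convex_conjugate_ge psi (- d) y.
rewrite -(fineK f1) in h1; rewrite -(fineK f2) in h2.
have P0 := cpsi_ge0 y.
have Pf : convex_conjugate psi y \is a fin_num.
  by rewrite ge0_fin_numE// (le_lt_trans (psi_le_young y))// ltry.
rewrite -(fineK Pf) in h1 h2 P0 *.
rewrite -EFinM -EFinD lee_fin -mulrDr mulrC ler_pdivlMr//.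
move: h1 h2 P0; rewrite -!EFinB !lee_fin /c.
by have [y0|y0] := ger0P y => *; lra.
Qed.

Let measurable_cpsi : measurable_fun setT (convex_conjugate psi).
Proof.
by apply: lower_semicontinuous_measurable; exact: convex_conjugate_lsc.
Qed.

(** The cumulant at 2s controls the conjugate of [psi] at s g, because s g is the midpoint of 2s g +
    l and - l. The absolute value is handled by adding the values at t g and - t g, both
    nonnegative, and the linear term by [psi_coercive]. *)
Lemma strongly_subexponential_young d (T : measurableType d)
    (nu : {finite_measure set T -> \bar R}) (g : {mfun_ nu, T >-> R}) (t : R) :
  strongly_subexponential phi g -> (0 < t)%R ->
  \int[nu]_x (young phi (t * `|g x|))%:E < +oo.
Proof.
move=> gsub t0.
have mg : measurable_fun setT (g : T -> R) by exact: measurable_funPT.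
have mP (s l : R) :
    measurable_fun setT (fun x : T => convex_conjugate psi (s * g x + l)%R).
  apply: measurableT_comp => //; apply: measurable_funD => //.
  exact: measurable_funM.
have mP0 (s : R) :
    measurable_fun setT (fun x : T => convex_conjugate psi (s * g x)%R).
  by apply: measurableT_comp => //; exact: measurable_funM.
have Pf y : convex_conjugate psi y \is a fin_num.
  by rewrite ge0_fin_numE// (le_lt_trans (psi_le_young y))// ltry.
(* The shift l depends on the scaling of g; convexity removes it. *)
have Ps (s : R) : \int[nu]_x convex_conjugate psi (s * g x)%R < +oo.
  have /ereal_inf_lt[_ [l _ <-] hl] := gsub (2 * s)%R.
  pose u (x : T) := 2^-1%:E * convex_conjugate psi (2 * s * g x + l)%R +
    (2^-1)%:E * convex_conjugate psi (- l)%R.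
  have h0 : 0 <= (2^-1 : R)%:E by rewrite lee_fin invr_ge0.
  apply: (@le_lt_trans _ _ (\int[nu]_x u x)).
    apply: ge0_le_integral => //.
      apply: emeasurable_funD => //.
      by apply: emeasurable_funM => //.
    move=> x _.
    have -> : (s * g x =
        2^-1 * (2 * s * g x + l) + (1 - 2^-1) * (- l))%R by lra.
    have := convex_conjugate_convex (2 * s * g x + l) (- l) psi_ge0.
    move=> /(_ 2^-1%R); rewrite /u.
    have -> : (1 - 2^-1 = 2^-1 :> R)%R by lra.
    by apply; apply/andP; split; lra.
  rewrite /u ge0_integralD//; last 3 first.
  - by move=> x _; rewrite mule_ge0.
  - exact: emeasurable_funM.
  - by move=> x _; rewrite mule_ge0.
  rewrite ge0_integralZl// integral_cst// lte_add_pinfty//.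
    by rewrite lte_mul_pinfty.
  rewrite lte_mul_pinfty ?mule_ge0 ?fin_numM// ltey_eq fin_num_measure//.
have [a [c [a0 c0 hac]]] := psi_coercive.
(* In 1 + a, the 1 comes from [young_le_psi], and a, like c, from bounding its linear term t |g| by
   coercivity. *)
pose v (x : T) := (1 + a)%:E * (convex_conjugate psi (t * g x)%R +
  convex_conjugate psi (- t * g x)%R) + c%:E.
apply: (@le_lt_trans _ _ (\int[nu]_x v x)).
  apply: ge0_le_integral => //.
  - by move=> x _; rewrite lee_fin young_ge0// mulr_ge0// ltW.
  - apply/measurable_EFinP; apply: measurableT_comp.
      exact: measurable_young.
    by apply: measurable_funM => //; exact: measurableT_comp.
  - apply: emeasurable_funD => //; apply: emeasurable_funM => //.
    exact: emeasurable_funD.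
  - move=> x _; rewrite /v.
    apply: le_trans (young_le_psi _) _.
    have h : convex_conjugate psi (t * `|g x|)%R <=
        convex_conjugate psi (t * g x)%R + convex_conjugate psi (- t * g x)%R.
      have [g0|g0] := ger0P (g x); first by rewrite leeDl.
      by rewrite mulrN -mulNr leeDr.
    have := hac (t * `|g x|)%R.
    rewrite ger0_norm ?mulr_ge0 ?(ltW t0)//.
    move: h; rewrite -(fineK (Pf (t * `|g x|)%R)) -(fineK (Pf (t * g x)%R)).
    rewrite -(fineK (Pf (- t * g x)%R)).
    rewrite -!EFinD !lee_fin => h1 h2.
    have := ler_wpM2l (addr_ge0 ler01 a0) h1; lra.
rewrite /v ge0_integralD//; last 2 first.
- by move=> x _; rewrite mule_ge0 ?adde_ge0// lee_fin addr_ge0.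
- by apply: emeasurable_funM => //; exact: emeasurable_funD.
have a1 : 0 <= (1 + a)%:E by rewrite lee_fin addr_ge0.
rewrite ge0_integralZl//; last 2 first.
- exact: emeasurable_funD.
- by move=> x _; rewrite adde_ge0.
rewrite ge0_integralD// integral_cst// lte_add_pinfty//.
  by rewrite lte_mul_pinfty// lte_add_pinfty// Ps.
by rewrite lte_mul_pinfty ?lee_fin// ltey_eq fin_num_measure.
Qed.

End young.

(** * Affine minorants *)

Section affine_minorants.
Context (R : realType).

(** A one-dimensional separation argument: the line passes through (x0, c') with c < c' < f x0, and
    its slope is the supremum of the slopes of the chords joining that point to the graph on its
    left. The last hypothesis makes this set of slopes nonempty. *)
Lemma affine_minorant (f : R -> \bar R) (x0 c : R) :
  (forall x, 0 <= f x) ->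
  (forall (x y t : R), (0 <= t <= 1)%R ->
    f (t * x + (1 - t) * y)%R <= t%:E * f x + (1 - t)%:E * f y) ->
  lower_semicontinuous f ->
  c%:E < f x0 -> (exists2 x, (x < x0)%R & f x < +oo) ->
  exists y b : R, (forall x, (y * x - b)%:E <= f x) /\ (c < y * x0 - b)%R.
Proof.
move=> f0 fconv flsc cfx0 [x1 x10 fx1].
have [c' cc' c'f] : exists2 c' : R, (c < c')%R & c'%:E < f x0.
  case: (f x0) cfx0 => [r| |]//.
    rewrite lte_fin => cr; exists ((c + r) / 2)%R; rewrite ?lte_fin; lra.
  by move=> _; exists (c + 1)%R; [lra|exact: ltry].
have fE x : f x < +oo -> f x = (fine (f x))%:E.
  by move=> h; rewrite fineK ?ge0_fin_numE.
have [V nV hV] := flsc _ _ c'f.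
have [e /= e0 he] := nV.
pose slope x := ((c' - fine (f x)) / (x0 - x))%R.
pose S := [set slope x | x in [set x | (x < x0)%R /\ f x < +oo]].
(* At distance at least [e] from [x0] the numerator is at most |c'| because [f] is nonnegative;
   closer to [x0], semicontinuity gives f x > c' and the slope is negative. *)
have Sub s : S s -> (s <= `|c'| / e)%R.
  move=> [x [xx0 fx] <-]; rewrite /slope ler_pdivrMr ?subr_gt0//.
  have r0 : (0 <= `|c'| / e)%R by rewrite divr_ge0// ltW.
  have := ler_norm c'; have := f0 x; rewrite (fE _ fx) lee_fin => fx0 hc.
  have [xe|xe] := leP e (x0 - x)%R.
    have h : (`|c'| / e * e <= `|c'| / e * (x0 - x))%R by exact: ler_wpM2l.
    by rewrite divfK ?gt_eqF// in h; lra.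
  have /hV : V x by apply: he; rewrite /ball_ /= gtr0_norm ?subr_gt0.
  rewrite (fE _ fx) lte_fin => h.
  have : (0 <= `|c'| / e * (x0 - x))%R by rewrite mulr_ge0// subr_ge0 ltW.
  lra.
have hS : has_sup S.
  by split; [exists (slope x1), x1|exists (`|c'| / e)%R => s /Sub].
pose y := sup S.
exists y, (y * x0 - c')%R; split; last by lra.
move=> x; have [fx|] := ltP (f x) +oo; last first.
  by rewrite leye_eq => /eqP ->; exact: leey.
rewrite (fE _ fx) lee_fin.
have [xx0|x0x|xE] := ltgtP x x0.
- have : (slope x <= y)%R by apply: sup_upper_bound => //; exists x.
  by rewrite /slope ler_pdivrMr ?subr_gt0//; lra.
- suff : (y <= (fine (f x) - c') / (x - x0))%R.
    by rewrite ler_pdivlMr ?subr_gt0//; lra.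
  apply: ge_sup; first exact: hS.1.
  move=> _ [z [zx0 fz] <-]; rewrite /slope.
  rewrite ler_pdivrMr ?subr_gt0// mulrAC ler_pdivlMr ?subr_gt0//.
  (* Here z < x0 < x. Writing [x0] as a convex combination of [z] and [x] with weight [t], convexity
     puts the chord above c' at [x0], which is the required comparison of slopes. *)
  have zx : (0 < x - z)%R by lra.
  pose t := ((x - x0) / (x - z))%R.
  have t01 : (0 <= t <= 1)%R.
    by rewrite divr_ge0 ?ler_pdivrMr//=; lra.
  have tz : (t * (x - z) = x - x0)%R by rewrite divfK// gt_eqF.
  have := fconv z x t t01.
  have -> : (t * z + (1 - t) * x = x0)%R by lra.
  move=> /(lt_le_trans c'f); rewrite (fE _ fx) (fE _ fz) -!EFinM -EFinD lte_fin.
  move=> h; have := ltr_pM2r zx c' (t * fine (f z) + (1 - t) * fine (f x))%R.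
  rewrite h => /esym.
  by rewrite mulrDl (mulrAC t) tz mulrAC (mulrBl _ 1%R t) tz; lra.
- by rewrite xE in fx *; have := ltW c'f; rewrite (fE _ fx) lee_fin; lra.
Qed.

Context (phi : R -> \bar R) (hphi : divergence_function phi).

(** [affine_minorant] needs a point of the domain to the left. For x0 > 1 the point 1 serves, for x0
    = 1 the neighborhood of 1 provides one, and for x0 < 1 the reflection x -> -x moves 1 to the
    left side. *)
Lemma divergence_affine_minorant (x0 c : R) : c%:E < phi x0 ->
  exists y b : R, (forall x, (y * x - b)%:E <= phi x) /\ (c < y * x0 - b)%R.
Proof.
move=> cphi; have phi0 := divergence_ge0 hphi.
have phi1 : phi 1%R < +oo by rewrite (divergence_at1 hphi).
have [x01|x01] := ltP x0 1%R.
- have [| | | | |y [b [h1 h2]]] := @affine_minorant (phi \o -%R) (- x0) c.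
  + by move=> x; exact: phi0.
  + move=> x y t t01 /=; rewrite opprD -!mulrN.
    exact: divergence_convex.
  + move=> x a /= /(divergence_lsc hphi)[V nV hV].
    exists (-%R @^-1` V); last by move=> z /hV.
    by have := @opp_continuous R x; apply.
  + by rewrite /= opprK.
  + by exists (-1)%R; [lra|rewrite /= opprK].
  exists (- y)%R, b; split; last by lra.
  by move=> x; have := h1 (- x)%R; rewrite /= opprK mulrN mulNr.
- apply: affine_minorant => //.
  + exact: divergence_convex.
  + exact: divergence_lsc.
  + have [->|x1] := eqVneq x0 1%R; last by exists 1%R => //; rewrite lt_def x1.
    have [e /= e0 he] := divergence_dom hphi.
    exists (1 - e / 2)%R; first lra.
    by apply: he; rewrite /ball_ /= opprB addrC subrK gtr0_norm; lra.
Qed.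

(* Lowering the slope slightly keeps a line below phi on [0, +oo[, hence
   rational slopes and intercepts suffice. *)
Lemma divergence_affine_sup : exists a b : nat -> R,
  (forall n x, (0 <= x)%R -> (a n * x - b n)%:E <= phi x) /\
  (forall x c, (0 <= x)%R -> c%:E < phi x -> exists n, (c < a n * x - b n)%R).
Proof.
pose minorant (p : rat * rat) :=
  forall x : R, (0 <= x)%R -> (ratr p.1 * x - ratr p.2)%:E <= phi x.
(* Pairs that are not minorants are replaced by the zero line, so that every index yields a
   minorant. *)
pose p n : rat * rat := if unpickle n is Some p then
  if `[< minorant p >] then p else (0%R, 0%R) else (0%R, 0%R).
have p0 : minorant (0%R, 0%R).
  by move=> x x0; rewrite /= rmorph0 mul0r subr0 (divergence_ge0 hphi).
exists (fun n => ratr (p n).1), (fun n => ratr (p n).2); split.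
  move=> n; rewrite -/(minorant (p n)) /p; case: unpickle => // q.
  by case: ifPn => // /asboolP.
move=> x c x0 /divergence_affine_minorant[y [b [h1 h2]]].
(* The gap [e] is shared: lowering the slope costs at most e / 2 at [x], raising the intercept less
   than e / 2. The denominator uses x + 1 because [x] may be 0. *)
pose e := (y * x - b - c)%R.
have e0 : (0 < e)%R by rewrite /e; lra.
have x2 : (0 < 2 * (x + 1))%R by lra.
have ye : (y - e / (2 * (x + 1)) < y)%R by rewrite ltrBlDr ltrDl divr_gt0.
have [q] := rat_in_itvoo ye.
rewrite in_itv /= => /andP[q1 q2].
have be : (b < b + e / 2)%R by lra.
have [r] := rat_in_itvoo be.
rewrite in_itv /= => /andP[r1 r2].
have mqr : minorant (q, r).
  move=> z z0 /=; apply: le_trans (h1 z); rewrite lee_fin.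
  have := ler_wpM2r z0 (ltW q2); lra.
exists (pickle (q, r)); rewrite /p pickleK asboolT//=.
have : ((y - e / (2 * (x + 1))) * x <= ratr q * x)%R by rewrite ler_wpM2r// ltW.
have : (e / (2 * (x + 1)) * x <= e / 2)%R.
  rewrite mulrAC ler_pdivrMr// -mulrA ler_wpM2l ?(ltW e0)//; lra.
rewrite mulrBl /e; move: r2; rewrite /e; lra.
Qed.

End affine_minorants.

Section affine_max.
Context (R : realType) (a b : nat -> R).

(** Starting at 0 loses nothing below a nonnegative [phi], and keeps every stage nonnegative, so
    that integrals split over sets and monotone convergence applies. *)
Fixpoint affine_max (n : nat) (x : R) : R :=
  if n is m.+1 then Num.max (affine_max m x) (a m * x - b m)%R else 0%R.

Lemma affine_max_ge0 n x : (0 <= affine_max n x)%R.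
Proof. by elim: n => //= n IH; rewrite le_max IH. Qed.

Lemma affine_max_nd x :
  {homo affine_max ^~ x : m n / (m <= n)%N >-> (m <= n)%R}.
Proof.
by apply: homo_leq => //= [z y w|n]; [exact: le_trans|rewrite le_max lexx].
Qed.

Lemma measurable_affine_max n : measurable_fun setT (affine_max n).
Proof.
elim: n => [|n IH]; first exact: measurable_cst.
by apply: measurable_maxr => //; exact: measurable_funB.
Qed.

Lemma affine_max_cvg (phi : R -> \bar R) (x : R) : 0 <= phi x ->
  (forall n, (a n * x - b n)%:E <= phi x) ->
  (forall c, c%:E < phi x -> exists n, (c < a n * x - b n)%R) ->
  (affine_max n x)%:E @[n --> \oo] --> phi x.
Proof.
move=> phi0 h1 h2.
have le_phi n : (affine_max n x)%:E <= phi x.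
  by elim: n => //= n IH; rewrite EFin_max ge_max IH h1.
have -> : phi x = ereal_sup (range (fun n => (affine_max n x)%:E)).
  apply/le_anti/andP; split; last by apply: ge_ereal_sup => _ [n _ <-].
  set s := ereal_sup _; rewrite leNgt; apply/negP => sphi.
  have s0 : 0 <= s by apply: ereal_sup_ubound; exists 0%N.
  have sfin : s \is a fin_num.
    by rewrite ge0_fin_numE// (lt_le_trans sphi)// leey.
  rewrite -(fineK sfin) in sphi; have [n hn] := h2 _ sphi.
  suff : (fine s)%:E < s by rewrite fineK// ltxx.
  (* Stage [n] only involves the affine functions of index below [n], hence the successor. *)
  apply: (@lt_le_trans _ _ (affine_max n.+1 x)%:E).
    by rewrite lte_fin /= lt_max hn orbT.
  by apply: ereal_sup_ubound; exists n.+1.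
by apply: ereal_nondecreasing_cvgn => m n mn; rewrite lee_fin affine_max_nd.
Qed.

End affine_max.

(** * Uniform integrability *)

Section density_ball.
Context (R : realType) d (T : measurableType d).
Context (phi : R -> \bar R) (nu : {finite_measure set T -> \bar R}).
Implicit Types (f g h : T -> R) (tau : R).

Definition density_ball tau : set (T -> R) :=
  [set f : T -> R | [/\ measurable_fun setT f, (forall x, 0 <= f x)%R &
    \int[nu]_x phi (f x) <= tau%:E]].

(** This is the Orlicz heart of the conjugate: all multiples are required, not just one, because a
    small error calls for a large t. *)
Definition young_integrable h := measurable_fun setT h /\
  forall t, (0 < t)%R -> \int[nu]_x (young phi (t * `|h x|))%:E < +oo.

Hypotheses (hphi : divergence_function phi) (hslope : slope_pinfty phi = +oo).

Let measurable_young_comp h : measurable_fun setT h ->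
  measurable_fun setT (fun x => (young phi (h x))%:E).
Proof.
move=> mh; apply/measurable_EFinP.
by apply: measurableT_comp => //; exact: measurable_young.
Qed.

Let measurable_phi_comp f : measurable_fun setT f ->
  measurable_fun setT (fun x => phi (f x)).
Proof. by apply: measurableT_comp; exact: measurable_divergence. Qed.

Lemma young_integrable_le h g : measurable_fun setT g ->
  (forall x, `|g x| <= `|h x|)%R -> young_integrable h -> young_integrable g.
Proof.
move=> mg gh [mh hh]; split => // t t0; apply: le_lt_trans (hh t t0).
apply: ge0_le_integral => //.
- by move=> x _; rewrite lee_fin (young_ge0 hphi hslope)// mulr_ge0// ltW.
- apply: measurable_young_comp; apply: measurable_funM => //.
  exact: measurableT_comp.
- apply: measurable_young_comp; apply: measurable_funM => //.
  exact: measurableT_comp.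
- move=> x _; rewrite lee_fin (young_nondecreasing hphi hslope)//.
  by rewrite ler_wpM2l// ltW.
Qed.

Lemma young_integrable_cst c : young_integrable (fun=> c).
Proof.
split; first exact: measurable_cst.
move=> t t0; rewrite integral_cst// lte_mul_pinfty//.
  by rewrite lee_fin (young_ge0 hphi hslope)// mulr_ge0// ltW.
by rewrite ltey_eq fin_num_measure.
Qed.

Lemma young_integrable_indic A : measurable A -> young_integrable \1_A.
Proof.
move=> mA; apply: young_integrable_le (young_integrable_cst 1).
  exact: measurable_indic.
by move=> x; rewrite indicE; case: (_ \in _); rewrite ?normr1 ?normr0.
Qed.

Lemma density_ball_young tau f h t : density_ball tau f ->
  measurable_fun setT h -> (forall x, 0 <= h x)%R -> (0 < t)%R ->
  t%:E * \int[nu]_x (h x * f x)%:E <=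
  tau%:E + \int[nu]_x (young phi (t * h x))%:E.
Proof.
move=> [mf f0 ftau] mh h0 t0.
have th0 x : (0 <= t * h x)%R by rewrite mulr_ge0// ltW.
rewrite -ge0_integralZl//; last 3 first.
- by apply/measurable_EFinP; exact: measurable_funM.
- by move=> x _; rewrite lee_fin mulr_ge0.
- by rewrite lee_fin ltW.
apply: (@le_trans _ _ (\int[nu]_x phi (f x) +
    \int[nu]_x (young phi (t * h x))%:E)); last by rewrite leeD2r.
have mth : measurable_fun setT (fun x => t * h x)%R by exact: measurable_funM.
rewrite -ge0_integralD//; last 4 first.
- by move=> x _; exact: (divergence_ge0 hphi).
- exact: measurable_phi_comp.
- by move=> x _; rewrite lee_fin (young_ge0 hphi hslope).
- exact: measurable_young_comp.
apply: ge0_le_integral => //.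
- by move=> x _; rewrite -EFinM lee_fin !mulr_ge0// ltW.
- apply/measurable_EFinP; apply: measurable_funM => //.
  exact: measurable_funM.
- apply: emeasurable_funD; first exact: measurable_phi_comp.
  exact: measurable_young_comp.
- move=> x _; have := young_inequality hphi hslope (f x) (t * h x).
  by rewrite mulrC -mulrA EFinM.
Qed.

Lemma density_ball_integrable tau f h : density_ball tau f ->
  young_integrable h -> nu.-integrable setT (fun x => (h x * f x)%:E).
Proof.
move=> ftau [mh hh]; have [mf f0 _] := ftau.
apply/integrableP; split.
  by apply/measurable_EFinP; exact: measurable_funM.
have mnh : measurable_fun setT (fun x => `|h x|%R) by exact: measurableT_comp.
have := density_ball_young ftau mnh (fun x => normr_ge0 (h x)) ltr01.
rewrite mul1e.
under eq_integral do rewrite -[X in (_ * X)%R]ger0_norm// -normrM.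
move=> /le_lt_trans; apply; rewrite lte_add_pinfty ?ltry//.
exact: hh.
Qed.

Lemma density_ball_integrable_in tau f A : density_ball tau f -> measurable A ->
  nu.-integrable A (EFin \o f).
Proof.
move=> ftau mA; apply: (@integrableS _ _ _ _ setT) => //.
have := density_ball_integrable ftau (young_integrable_cst 1).
by apply: eq_integrable => // x _; rewrite mul1r.
Qed.

(* De la Vallee-Poussin: superlinearity of phi makes the densities of a ball
   uniformly integrable, even after multiplication by a Young-integrable
   envelope. *)
Lemma density_ball_small tau (h : nat -> T -> R) (H : T -> R) (e : R) :
  (forall n, measurable_fun setT (h n)) ->
  (forall n x, 0 <= h n x <= `|H x|)%R ->
  (forall x, h n x @[n --> \oo] --> (0:R)%R) ->
  young_integrable H -> (0 < e)%R ->
  \forall n \near \oo, forall f, density_ball tau f ->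
    \int[nu]_x (h n x * f x)%:E <= e%:E.
Proof.
move=> mh hH h0 [mH HH] e0.
(* With this [t], [tau] is at most half of t e; the integral of [young phi (t * h n x)], in which no
   density occurs, is eventually below the other half. Hence the uniformity in [f]. *)
pose t := (2 * (`|tau| + 1) / e)%R.
have t0 : (0 < t)%R by rewrite divr_gt0// mulr_gt0// ltr_wpDl.
have th0 n x : (0 <= t * h n x)%R.
  by rewrite mulr_ge0 ?(ltW t0)//; have /andP[] := hH n x.
have cvy x : (young phi (t * h n x))%:E @[n --> \oo] --> (0:R)%:E.
  apply: cvg_EFin; first exact: nearW.
  (* As soon as t h <= 1, [young_scale] bounds young(t h) by t h young(1). *)
  apply: (@squeeze_cvgr _ _ _ _ (cst 0%R) (fun n => t * h n x * young phi 1)%R).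
  - have /cvgrPdist_lt/(_ _ (divr_gt0 ltr01 t0)) := h0 x.
    apply: filterS => n; rewrite sub0r normrN => hn; rewrite /cst/=.
    rewrite (young_ge0 hphi hslope)//=.
    rewrite -[X in young phi X]mulr1 (young_scale hphi hslope)// th0/=.
    by rewrite mulrC -ler_pdivlMr// ltW// (le_lt_trans _ hn)// ler_norm.
  - exact: cvg_cst.
  - rewrite -[X in _ --> X](mul0r (young phi 1)) -{1}(mulr0 t).
    by apply: cvgMl; apply: cvgMr; exact: h0.
have mth n : measurable_fun setT (fun x => t * h n x)%R.
  exact: measurable_funM.
have [] := @dominated_convergence _ T R nu setT measurableT
  (fun n x => (young phi (t * h n x))%:E) (cst 0)
  (fun x => (young phi (t * `|H x|))%:E).
- by move=> n; exact: measurable_young_comp.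
- exact: measurable_cst.
- by apply: aeW => x _; exact: cvy.
- have mtH : measurable_fun setT (fun x => t * `|H x|)%R.
    by apply: measurable_funM => //; exact: measurableT_comp.
  apply/integrableP; split; first exact: measurable_young_comp.
  under eq_integral.
    move=> x _; rewrite gee0_abs; last first.
      by rewrite lee_fin (young_ge0 hphi hslope)// mulr_ge0// ltW.
    over.
  exact: HH.
- apply: aeW => x n _; rewrite gee0_abs.
    rewrite lee_fin (young_nondecreasing hphi hslope)// ler_wpM2l ?(ltW t0)//.
    by have /andP[] := hH n x.
  by rewrite lee_fin (young_ge0 hphi hslope).
move=> _ _; rewrite integral0 => /fine_cvgP[hfin].
have te0 : (0 < t * e / 2)%R by rewrite divr_gt0// mulr_gt0.
move=> /cvgrPdist_lt/(_ _ te0) hlt.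
near=> n => f ftau.
have hn0 x : (0 <= h n x)%R by have /andP[] := hH n x.
have := density_ball_young ftau (mh n) hn0 t0.
have yfin : \int[nu]_x (young phi (t * h n x))%:E \is a fin_num by near: n.
have : (`|0 - fine (\int[nu]_x (young phi (t * h n x))%:E)| < t * e / 2)%R.
  by near: n.
rewrite -(fineK yfin) sub0r normrN => /(le_lt_trans (ler_norm _)) ylt hle.
rewrite -(@lee_pmul2l _ t%:E)// (le_trans hle)// -EFinD -EFinM lee_fin.
have : (t * e = 2 * (`|tau| + 1))%R by rewrite divfK// gt_eqF.
by have := ler_norm tau; lra.
Unshelve. all: by end_near. Qed.

End density_ball.

(** * Ultrafilter limits of densities *)

(** The compact segment [-M, M] provides a cluster point, and an ultrafilter converges to each of
    its cluster points. *)
Lemma ultrafilter_bounded_cvg (R : realType) (I : Type) (F : set_system I)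
    (u : I -> R) (M : R) : UltraFilter F -> (forall i, `|u i| <= M)%R ->
  exists l : R, u i @[i --> F] --> l.
Proof.
move=> FU uM; have [|l [_ lF]] := @segment_compact R (- M) M (u @ F).
  by apply: nearW => i; rewrite /= in_itv /= -ler_norml.
exists l => V nV; have [//|FV] := in_ultra_setVsetC (u @^-1` V) FU.
by have [x [? ?]] := lF (~` V) V FV nV.
Qed.

Section radon_nikodym_real.
Context (R : realType) d (T : measurableType d).
Context (nu : {finite_measure set T -> \bar R}).

(** The derivative is first obtained with extended real values, finite almost everywhere; [fine]
    alters it on a null set only. *)
Lemma radon_nikodym_real (l : set T -> R) : (forall A, 0 <= l A)%R ->
  semi_sigma_additive (EFin \o l) ->
  (forall A, measurable A -> nu A = 0 -> l A = 0%R) ->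
  exists f : T -> R, [/\ measurable_fun setT f, (forall x, 0 <= f x)%R &
    forall A, measurable A -> (l A)%:E = \int[nu]_(x in A) (f x)%:E].
Proof.
move=> l0 lsigma lnu.
have m0 : (EFin \o l) set0 = 0 by rewrite /= lnu ?measure0.
have mge0 A : 0 <= (EFin \o l) A by rewrite lee_fin.
pose m : {measure set T -> \bar R} :=
  HB.pack (EFin \o l) (isMeasure.Build _ _ _ (EFin \o l) m0 mge0 lsigma).
have mfin : fin_num_fun m by [].
pose m' : {finite_measure set T -> \bar R} :=
  HB.pack (EFin \o l) m (Measure_isFinite.Build _ _ _ m mfin).
have mnu : m' `<< nu.
  by apply/null_content_dominatesP => A mA nuA; rewrite /= lnu.
have [f [f0 fint fE]] := radon_nikodym_finite mnu.
have mf := measurable_int _ fint.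
exists (fine \o f); split.
- by apply: measurableT_comp => //; exact: fine_measurable.
- by move=> x /=; exact: fine_ge0.
- move=> A mA; transitivity (m' A) => //; rewrite fE//.
  have mfA : measurable_fun A f by exact: measurable_funTS.
  apply: ge0_ae_eq_integral => //.
  + apply/measurable_EFinP.
    by apply: measurableT_comp => //; exact: fine_measurable.
  + by move=> x _; rewrite lee_fin fine_ge0.
  + have := integrable_ae measurableT fint.
    by apply: filterS => x /(_ Logic.I) fx _; rewrite /= fineK.
Qed.

End radon_nikodym_real.

Section ultrafilter_limit.
Context (R : realType) d (T : measurableType d).
Context (phi : R -> \bar R) (nu : {finite_measure set T -> \bar R}) (tau : R).
Hypotheses (hphi : divergence_function phi) (hslope : slope_pinfty phi = +oo).
Context (I : Type) (F : set_system I) (FU : UltraFilter F).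
Context (f_ : I -> T -> R) (f_ball : forall i, density_ball phi nu tau (f_ i)).
Implicit Types (A B : set T).

Let mass (f : T -> R) A : R := \int[nu]_(x in A) f x.

Let massE i A : measurable A ->
  (mass (f_ i) A)%:E = \int[nu]_(x in A) (f_ i x)%:E.
Proof.
move=> mA; rewrite /mass /Rintegral fineK//.
apply: integrable_fin_num => //.
exact: density_ball_integrable_in (f_ball i) mA.
Qed.

Let mass_ge0 i A : (0 <= mass (f_ i) A)%R.
Proof. by apply: Rintegral_ge0 => x _; have [] := f_ball i. Qed.

Let massU i A B : measurable A -> measurable B -> A `&` B = set0 ->
  mass (f_ i) (A `|` B) = (mass (f_ i) A + mass (f_ i) B)%R.
Proof.
move=> mA mB AB; apply: EFin_inj.
rewrite EFinD !massE//; last exact: measurableU.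
have [mf f0 _] := f_ball i.
rewrite ge0_integral_setU//.
- by apply/measurable_EFinP; exact: measurable_funTS.
- by move=> x _; rewrite lee_fin.
- by apply/disj_setPS; rewrite AB.
Qed.

Let mass_indic i A : measurable A ->
  (mass (f_ i) A)%:E = \int[nu]_x (\1_A x * f_ i x)%:E.
Proof.
move=> mA; rewrite massE// integral_mkcond; apply: eq_integral => x _.
by rewrite patchE indicE; case: ifP; rewrite ?mul1r ?mul0r.
Qed.

Let mass_le i A : measurable A -> (mass (f_ i) A <= mass (f_ i) setT)%R.
Proof.
move=> mA; rewrite -(setUv A) massU ?lerDl ?setICr//; exact: measurableC.
Qed.

(** Young's inequality with t = 1 and the constant function 1, whence the argument [1 * 1]. *)
Let mass_bound : exists M : R,
  forall i A, measurable A -> (`|mass (f_ i) A| <= M)%R.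
Proof.
pose c := \int[nu]_x (young phi (1 * 1))%:E.
have cfin : c \is a fin_num.
  rewrite /c integral_cst// fin_numM// fin_num_measure//.
exists (tau + fine c)%R => i A mA; rewrite ger0_norm//.
rewrite (le_trans (mass_le i mA))//.
have m1 : measurable_fun setT (fun _ : T => 1%R : R).
  exact: (@measurable_cst _ _ T).
have := density_ball_young hphi hslope (f_ball i) m1 (fun=> ler01) ltr01.
rewrite -lee_fin massE// mul1e EFinD (fineK cfin).
by under eq_integral do rewrite mul1r.
Qed.

Let limit_set_function : exists l : set T -> R,
  (forall A, measurable A -> mass (f_ i) A @[i --> F] --> l A) /\
  (forall A, 0 <= l A)%R.
Proof.
have [M hM] := mass_bound.
suff /choice[l hl] : forall A, exists l : R,
    (measurable A -> mass (f_ i) A @[i --> F] --> l) /\ (0 <= l)%R.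
  by exists l; split => A; have [] := hl A.
(* Nonmeasurable sets get the value 0, since a measure structure demands nonnegativity on all
   sets. *)
move=> A; have [mA|nmA] := pselect (measurable A); last by exists 0%R.
have [l hl] := ultrafilter_bounded_cvg FU (fun i => hM i A mA).
exists l; split => //.
by apply: (cvgr_to_ge hl); exact: nearW.
Qed.

Lemma ultrafilter_limit_density : exists f : T -> R,
  [/\ measurable_fun setT f, (forall x, 0 <= f x)%R,
    nu.-integrable setT (EFin \o f) &
    forall A, measurable A ->
      (\int[nu]_(x in A) f_ i x)%R @[i --> F] --> (\int[nu]_(x in A) f x)%R].
Proof.
have [l [lcvg l0]] := limit_set_function.
have lU A B : measurable A -> measurable B -> A `&` B = set0 ->
    l (A `|` B) = (l A + l B)%R.
  move=> mA mB AB.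
  have h := lcvg _ (measurableU _ _ mA mB).
  apply: (cvg_unique _ h) => //=.
  have -> : (fun i => mass (f_ i) (A `|` B)) =
      (fun i => mass (f_ i) A + mass (f_ i) B)%R.
    by apply/funext => i; rewrite massU.
  by apply: cvgD; exact: lcvg.
have lnull A : measurable A -> nu A = 0 -> l A = 0%R.
  move=> mA nuA; apply: (cvg_unique _ (lcvg A mA)) => //=.
  have -> : (fun i => mass (f_ i) A) = cst 0%R.
    apply/funext => i; apply: EFin_inj; rewrite massE//.
    apply: null_set_integral => //; apply/measurable_EFinP.
    by apply: measurable_funTS; have [] := f_ball i.
  exact: cvg_cst.
(* Continuity of [l] at the empty set: when every point eventually leaves the sets, their masses are
   small uniformly over the ball, and the bound passes to the limit. *)
have lsmall (B : nat -> set T) (e : R) : (forall n, measurable (B n)) ->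
    (forall x, \forall n \near \oo, ~ B n x) -> (0 < e)%R ->
    \forall n \near \oo, (l (B n) <= e)%R.
  move=> mB Bx e0.
  have := @density_ball_small _ _ _ phi nu hphi hslope tau (fun n => \1_(B n))
    (fun=> 1%R) e.
  move=> []//.
  - move=> n x; rewrite indicE.
    by case: (_ \in _); rewrite /= normr1 ?ler01 ?lexx.
  - move=> x; apply/cvgrPdist_lt => eps eps0.
    apply: filterS (Bx x) => n nBx.
    by rewrite indicE memNset//= subr0 normr0.
  - exact: young_integrable_cst.
  move=> N _ hN; exists N => // n /hN hn.
  apply: (cvgr_to_le (lcvg _ (mB n))); apply: nearW => i.
  by rewrite -lee_fin mass_indic// hn.
have lsigma : semi_sigma_additive (EFin \o l).
  move=> B mB tB mUB.
  have lsum n : (\sum_(0 <= i < n) (EFin \o l) (B i))%E =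
      (l (\big[setU/set0]_(i < n) B i))%:E.
    elim: n => [|n IH]; first by rewrite big_geq// big_ord0 lnull.
    rewrite big_nat_recr//= IH big_ord_recr/= lU//.
      exact: bigsetU_measurable.
    rewrite -bigcup_mkord; apply/seteqP; split => // x [[i /= + Bi] Bn].
    by rewrite (tB i n Logic.I Logic.I (ex_intro _ x (conj Bi Bn))) ltnn.
  have -> : (fun n => (\sum_(0 <= i < n) (EFin \o l) (B i))%E) =
      (fun n => (l (\big[setU/set0]_(i < n) B i))%:E) by exact/funext.
  apply: cvg_EFin; first exact: nearW.
  apply/cvgrPdist_le => e e0.
  (* By finite additivity, the error of the n-th partial sum is [l (C n)], and every point
     eventually leaves these remainders. *)
  pose C n := \bigcup_i B i `\` \big[setU/set0]_(i < n) B i.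
  have mU n : measurable (\big[setU/set0]_(i < n) B i).
    exact: bigsetU_measurable.
  have mC n : measurable (C n) by exact: measurableD.
  apply: filterS (lsmall C e mC _ e0).
    move=> n lC /=.
    have -> : \bigcup_n0 B n0 = (\big[setU/set0]_(i < n) B i) `|` C n.
      rewrite /C setDUK// -bigcup_mkord.
      by apply: bigcup_sub => i _; exact: bigcup_sup.
    by rewrite lU ?setDIK// addrAC subrr add0r ger0_norm.
  move=> x; have [[k _ Bkx]|nBx] := pselect ((\bigcup_i B i) x); last first.
    by apply: nearW => n [].
  exists k.+1 => // n /= kn [_]; apply.
  by rewrite -bigcup_mkord; exists k.
have [f [mf f0 fl]] := radon_nikodym_real l0 lsigma lnull.
exists f; split => //.
- apply/integrableP; split; first exact/measurable_EFinP.
  under eq_integral do rewrite gee0_abs ?lee_fin//.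
  by rewrite -fl// ltry.
- by move=> A mA; rewrite /Rintegral -fl//; exact: lcvg.
Qed.

End ultrafilter_limit.

(** * Lower semicontinuity of the divergence under convergence of masses *)

Section density_ball_closed.
Context (R : realType) d (T : measurableType d).
Context (phi : R -> \bar R) (nu : {finite_measure set T -> \bar R}) (tau : R).
Hypotheses (hphi : divergence_function phi) (hslope : slope_pinfty phi = +oo).
Context (I : Type) (F : set_system I) (FF : ProperFilter F).
Context (f_ : I -> T -> R) (f_ball : forall i, density_ball phi nu tau (f_ i)).
Context (f : T -> R) (mf : measurable_fun setT f) (f0 : forall x, (0 <= f x)%R).
Hypothesis fint : nu.-integrable setT (EFin \o f).
Hypothesis fcvg : forall A, measurable A ->
  (\int[nu]_(x in A) f_ i x)%R @[i --> F] --> (\int[nu]_(x in A) f x)%R.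

Let measurable_phi i : measurable_fun setT (fun x => phi (f_ i x)).
Proof.
apply: measurableT_comp; first exact: measurable_divergence.
by have [] := f_ball i.
Qed.

Let integrable_phi i : nu.-integrable setT (fun x => phi (f_ i x)).
Proof.
apply/integrableP; split; first exact: measurable_phi.
under eq_integral do rewrite gee0_abs ?(divergence_ge0 hphi)//.
by have [_ _ /le_lt_trans] := f_ball i; apply; exact: ltry.
Qed.

Let integrable_affine (g : T -> R) (a b : R) (A : set T) : measurable A ->
  nu.-integrable A (EFin \o g) ->
  nu.-integrable A (fun x => (a * g x - b)%:E).
Proof.
move=> mA ig.
have -> : (fun x => (a * g x - b)%:E) =
  (fun x => a%:E * (g x)%:E) \- cst b%:E by [].
apply: integrableB => //; first exact: integrableZl.
exact: finite_measure_integrable_cst.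
Qed.

Let integral_affine (g : T -> R) (a b : R) (A : set T) : measurable A ->
  nu.-integrable A (EFin \o g) ->
  \int[nu]_(x in A) (a * g x - b)%:E =
  (a * (\int[nu]_(x in A) g x) - b * fine (nu A))%:E.
Proof.
move=> mA ig; under eq_integral do rewrite EFinB EFinM.
rewrite integralB//; last 2 first.
- exact: integrableZl.
- exact: finite_measure_integrable_cst.
rewrite integralZl// integral_cst// EFinB !EFinM; congr (_ * _ - _ * _).
  by rewrite /Rintegral fineK//; exact: integrable_fin_num.
by rewrite fineK// fin_num_measure.
Qed.

(** Quantifying over all [A] makes the induction possible: each stage cuts [A] in two and applies
    the induction hypothesis to one piece. The slack [e] replaces a lower limit along [F]. *)
Let affine_max_near (a b : nat -> R) n :
  (forall n x, (0 <= x)%R -> (a n * x - b n)%:E <= phi x) ->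
  forall A e, measurable A -> (0 < e)%R -> \forall i \near F,
    \int[nu]_(x in A) (affine_max a b n (f x))%:E <=
    \int[nu]_(x in A) phi (f_ i x) + e%:E.
Proof.
move=> habphi; elim: n => [|n IH] A e mA e0.
  apply: nearW => i /=; rewrite integral0 adde_ge0 ?lee_fin ?(ltW e0)//.
  by apply: integral_ge0 => x _; exact: (divergence_ge0 hphi).
pose u x := affine_max a b n (f x).
pose v x := (a n * f x - b n)%R.
have mu : measurable_fun setT u.
  by apply: measurableT_comp => //; exact: measurable_affine_max.
have mv : measurable_fun setT v.
  by apply: measurable_funB => //; exact: measurable_funM.
(* On [B] the new affine function is the maximum, and its integral is affine in the mass of [B],
   hence converges; the complement [C] falls to the induction hypothesis. Each piece costs e / 2. *)
pose B := A `&` [set x | u x <= v x]%R.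
have mB : measurable B.
  by apply: measurable_fun_le => //; exact: measurable_funTS.
pose C := A `\` B; have mC : measurable C by exact: measurableD.
have AE : A = B `|` C by rewrite /C setDUK// => x [].
have BC : [disjoint B & C] by apply/disj_setPS; rewrite /C setDIK.
have mmax : measurable_fun setT (fun x => (affine_max a b n.+1 (f x))%:E).
  apply/measurable_EFinP; apply: measurableT_comp => //.
  exact: measurable_affine_max.
have -> : \int[nu]_(x in A) (affine_max a b n.+1 (f x))%:E =
    \int[nu]_(x in B) (v x)%:E + \int[nu]_(x in C) (u x)%:E.
  rewrite [in LHS]AE ge0_integral_setU//; last 2 first.
  - exact: measurable_funTS.
  - by move=> x _; rewrite lee_fin affine_max_ge0.
  congr (_ + _); apply: eq_integral => x; rewrite inE.
    by move=> [_ /= uv]; rewrite /= max_r.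
  move=> [Ax nBx]; rewrite /= max_l// leNgt; apply/negP => uv.
  by apply: nBx; split => //=; exact: ltW.
have splitA i : \int[nu]_(x in A) phi (f_ i x) =
    \int[nu]_(x in B) phi (f_ i x) + \int[nu]_(x in C) phi (f_ i x).
  rewrite AE ge0_integral_setU//; first exact: measurable_funTS.
  by move=> x _; exact: (divergence_ge0 hphi).
have e2 : (0 < e / 2)%R by lra.
have vcvg : (a n * (\int[nu]_(x in B) f_ i x) - b n * fine (nu B))%R @[i --> F]
    --> (a n * (\int[nu]_(x in B) f x) - b n * fine (nu B))%R.
  by apply: cvgB; [apply: cvgMr; exact: fcvg|exact: cvg_cst].
move: vcvg => /cvgrPdist_lt/(_ _ e2); apply: filter_app.
have := IH C _ mC e2; apply: filterS => i hC hB.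
rewrite splitA [e in e%:E](splitr e) EFinD addeACA leeD//.
rewrite integral_affine//; last exact: integrableS fint.
apply: (@le_trans _ _ (\int[nu]_(x in B) (a n * f_ i x - b n)%:E + (e / 2)%:E)).
  rewrite integral_affine//; last first.
    exact: density_ball_integrable_in (f_ball i) mB.
  by rewrite -EFinD lee_fin; have := ltW (le_lt_trans (ler_norm _) hB); lra.
rewrite leeD2r//; apply: le_integral => //.
- apply: integrable_affine => //.
  exact: density_ball_integrable_in (f_ball i) mB.
- exact: integrableS (integrable_phi i).
- by move=> x _; apply: habphi; have [] := f_ball i.
Qed.

(* On the sets where a given affine minorant of phi realizes a finite maximum,
   the integral is a continuous function of the masses of measurable sets. *)
Lemma density_ball_closed : density_ball phi nu tau f.
Proof.
split => //; have [a [b [h1 h2]]] := divergence_affine_sup hphi.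
have affine_le n : \int[nu]_x (affine_max a b n (f x))%:E <= tau%:E.
  apply/lee_addgt0Pr => e e0.
  have [i hi] := filter_ex (affine_max_near n h1 measurableT e0).
  by rewrite (le_trans hi)// leeD2r//; have [] := f_ball i.
have : \int[nu]_x (affine_max a b n (f x))%:E @[n --> \oo] -->
    \int[nu]_x (limn (fun n => (affine_max a b n (f x))%:E)).
  apply: cvg_monotone_convergence => //.
  - move=> n; apply/measurable_EFinP; apply: measurableT_comp => //.
    exact: measurable_affine_max.
  - by move=> n x _; rewrite lee_fin affine_max_ge0.
  - by move=> x _ m n mn; rewrite lee_fin affine_max_nd.
have -> : \int[nu]_x (limn (fun n => (affine_max a b n (f x))%:E)) =
    \int[nu]_x phi (f x).
  apply: eq_integral => x _; apply/cvg_lim => //.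
  apply: affine_max_cvg => [|n|c]; first exact: (divergence_ge0 hphi).
    exact: h1.
  exact: h2.
by move=> /cvge_to_le; apply; apply: nearW => n; exact: affine_le.
Qed.

End density_ball_closed.

(** * From masses of sets to subexponential integrands *)

Section test_functions.
Import HBSimple HBNNSimple.
Context (R : realType) d (T : measurableType d).
Context (phi : R -> \bar R) (nu : {finite_measure set T -> \bar R}) (tau : R).
Hypotheses (hphi : divergence_function phi) (hslope : slope_pinfty phi = +oo).
Context (I : Type) (F : set_system I) (FF : ProperFilter F).
Context (f_ : I -> T -> R) (f_ball : forall i, density_ball phi nu tau (f_ i)).
Context (f : T -> R) (fball : density_ball phi nu tau f).
Hypothesis fcvg : forall A, measurable A ->
  (\int[nu]_(x in A) f_ i x)%R @[i --> F] --> (\int[nu]_(x in A) f x)%R.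

(** Integrability against the whole ball is carried along because real-valued integrals are split
    below into sums and multiples, along the family as well as at the limit. *)
Let testing (h : T -> R) :=
  (forall g, density_ball phi nu tau g ->
    nu.-integrable setT (fun x => (h x * g x)%:E)) /\
  (\int[nu]_x (h x * f_ i x))%R @[i --> F] --> (\int[nu]_x (h x * f x))%R.

Let testingD h k : testing h -> testing k -> testing (fun x => h x + k x)%R.
Proof.
move=> [ih ch] [ik ck].
have iD g : density_ball phi nu tau g ->
    (\int[nu]_x ((h x + k x) * g x))%R =
    (\int[nu]_x (h x * g x) + \int[nu]_x (k x * g x))%R.
  move=> gb; rewrite -RintegralD//; [|exact: ih|exact: ik].
  by apply: eq_Rintegral => x _; rewrite mulrDl.
split.
  move=> g gb; have := integrableD measurableT (ih _ gb) (ik _ gb).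
  by apply: eq_integrable => // x _; rewrite mulrDl EFinD.
rewrite iD//; have -> : (fun i => \int[nu]_x ((h x + k x) * f_ i x))%R =
    (fun i => \int[nu]_x (h x * f_ i x) + \int[nu]_x (k x * f_ i x))%R.
  by apply/funext => i; rewrite iD.
exact: cvgD.
Qed.

Let testingZ c h : testing h -> testing (fun x => c * h x)%R.
Proof.
move=> [ih ch].
have iZ g : density_ball phi nu tau g ->
    (\int[nu]_x ((c * h x) * g x))%R = (c * \int[nu]_x (h x * g x))%R.
  move=> gb; rewrite -RintegralZl//; last exact: ih.
  by apply: eq_Rintegral => x _; rewrite mulrA.
split.
  move=> g gb; have := integrableZl measurableT c (ih _ gb).
  by apply: eq_integrable => // x _; rewrite -EFinM mulrA.
rewrite iZ//; have -> : (fun i => \int[nu]_x ((c * h x) * f_ i x))%R =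
    (fun i => c * \int[nu]_x (h x * f_ i x))%R.
  by apply/funext => i; rewrite iZ.
exact: cvgMr.
Qed.

Let testing_indic A : measurable A -> testing \1_A.
Proof.
move=> mA; split.
  move=> g gb; apply: (density_ball_integrable hphi hslope gb).
  exact: young_integrable_indic.
have iE g : (\int[nu]_x (\1_A x * g x))%R = (\int[nu]_(x in A) g x)%R.
  rewrite [RHS]Rintegral_mkcond; apply: eq_Rintegral => x _.
  by rewrite patchE indicE; case: ifP; rewrite ?mul1r ?mul0r.
by rewrite iE; under eq_fun do rewrite iE; exact: fcvg.
Qed.

Let testing_sum n (h : 'I_n -> T -> R) : (forall i, testing (h i)) ->
  testing (fun x => \sum_(i < n) h i x)%R.
Proof.
elim: n h => [|n IH] h hh.
  have -> : (fun x => \sum_(i < 0) h i x)%R = \1_set0.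
    by apply/funext => x; rewrite big_ord0 indic0.
  exact: testing_indic.
have -> : (fun x => \sum_(i < n.+1) h i x)%R =
    (fun x => h ord0 x + \sum_(i < n) h (lift ord0 i) x)%R.
  by apply/funext => x; rewrite big_ord_recl.
by apply: testingD => //; exact: IH.
Qed.

Let testing_nnsfun (h : {nnsfun T >-> R}) : testing h.
Proof.
pose s := finmap.enum_fset (fset_set (range h)).
have -> : (h : T -> R) =
    (fun x => \sum_(i < size s) (s`_i * \1_(h @^-1` [set s`_i]) x))%R.
  by apply/funext => x; rewrite fimfunEord.
by apply: testing_sum => i; apply: testingZ; apply: testing_indic.
Qed.

(** An e / 3 argument: [density_ball_small], applied to the remainders h - s n with envelope [h],
    selects one simple function good for the whole ball, hence for every [f_ i] and for the limit
    [f]. *)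
Let testing_ge0 (h : T -> R) : young_integrable phi nu h ->
  (forall x, 0 <= h x)%R -> testing h.
Proof.
move=> hy h0; have mh := hy.1.
have ih g : density_ball phi nu tau g ->
    nu.-integrable setT (fun x => (h x * g x)%:E).
  by move=> gb; exact: (density_ball_integrable hphi hslope gb).
split => //; apply/cvgrPdist_lt => e e0.
have mEh : measurable_fun setT (EFin \o h) by exact/measurable_EFinP.
pose s n : {nnsfun T >-> R} := nnsfun_approx measurableT mEh n.
have hE0 x : setT x -> 0 <= (EFin \o h) x by move=> _; rewrite lee_fin.
have sh n x : (s n x <= h x)%R.
  by rewrite -lee_fin /s nnsfun_approxE; exact: (le_approx n hE0).
have scvg x : s n x @[n --> \oo] --> h x.
  have := cvg_nnsfun_approx measurableT mEh hE0 (Logic.I : setT x).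
  by move=> /fine_cvgP[_].
have e3 : (0 < e / 3)%R by lra.
have [] := @density_ball_small _ _ _ phi nu hphi hslope tau
  (fun n x => h x - s n x)%R h (e / 3)%R _ _ _ hy e3.
- by move=> n; exact: measurable_funB.
- by move=> n x; rewrite subr_ge0 sh/= ger0_norm// gerBl.
- by move=> x; rewrite -(subrr (h x)); apply: cvgB => //; exact: cvg_cst.
move=> N _ /(_ N (leqnn N)) hN.
have [is_ cs] := testing_nnsfun (s N).
have close g : density_ball phi nu tau g ->
    (`|\int[nu]_x (h x * g x) - \int[nu]_x (s N x * g x)| <= e / 3)%R.
  move=> gb; have [_ g0 _] := gb.
  rewrite -RintegralB//; [|exact: ih|exact: is_].
  have -> : (\int[nu]_x (h x * g x - s N x * g x))%R =
      (\int[nu]_x ((h x - s N x) * g x))%R.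
    by apply: eq_Rintegral => x _; rewrite mulrBl.
  have p0 x : (0 <= (h x - s N x) * g x)%R by rewrite mulr_ge0// subr_ge0.
  rewrite ger0_norm; last exact: Rintegral_ge0.
  rewrite -lee_fin /Rintegral fineK; first exact: hN.
  rewrite ge0_fin_numE; last by apply: integral_ge0 => x _; rewrite lee_fin.
  exact: le_lt_trans (hN g gb) (ltry _).
move: cs => /cvgrPdist_lt/(_ _ e3); apply: filterS => i ci.
have := close f fball; have := close (f_ i) (f_ball i); move: ci.
rewrite !ltr_norml !ler_norml => /andP[? ?] /andP[? ?] /andP[? ?].
by apply/andP; split; lra.
Qed.

Lemma young_integrable_cvg (h : T -> R) : young_integrable phi nu h ->
  (\int[nu]_x (h x * f_ i x))%R @[i --> F] --> (\int[nu]_x (h x * f x))%R.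
Proof.
move=> hy; have mh := hy.1.
suff [] : testing h by [].
have -> : h = (fun x => Num.max (h x) 0 + -1 * Num.max (- h x) 0)%R.
  apply/funext => x; rewrite mulN1r.
  have [h0|h0] := leP 0%R (h x).
    by rewrite (max_idPr _) ?oppr_le0// subr0.
  by rewrite (max_idPl _) ?oppr_ge0 1?ltW// sub0r opprK.
apply: testingD; last apply: testingZ; apply: testing_ge0.
- apply: (young_integrable_le hphi hslope _ _ hy) => [|x].
    by apply: measurable_maxr => //; exact: measurable_cst.
  by have [h0|h0] := leP 0%R (h x); rewrite ?normr0.
- by move=> x; rewrite le_max lexx orbT.
- apply: (young_integrable_le hphi hslope _ _ hy) => [|x].
    by apply: measurable_maxr => //; exact: measurableT_comp.
  by have [h0|h0] := leP (- h x)%R 0%R; rewrite ?normr0 ?normrN.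
- by move=> x; rewrite le_max lexx orbT.
Qed.

End test_functions.

(** * Charges with a density *)

Section charge_density.
Local Open Scope charge_scope.
Context (R : realType) d (T : measurableType d).
Context (phi : R -> \bar R) (nu : {finite_measure set T -> \bar R}).
Implicit Types (mu : {charge set T -> \bar R}) (f : T -> R).

Definition has_density mu f := [/\ measurable_fun setT f,
  (forall x, 0 <= f x)%R & forall A, measurable A ->
    mu A = \int[nu]_(x in A) (f x)%:E].

Let measurable_hahn_pos mu : measurable (hahn_pos mu).
Proof. by have [[]] := hahn_decompositionP mu. Qed.

Let measurable_hahn_neg mu : measurable (hahn_neg mu).
Proof. by have [_ []] := hahn_decompositionP mu. Qed.

Lemma positive_partE mu A : measurable A ->
  positive_part mu A = mu (A `&` hahn_pos mu).
Proof. by move=> mA; rewrite /= cjordan_posE /crestr0 mem_set. Qed.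

Lemma negative_partE mu A : measurable A ->
  negative_part mu A = - mu (A `&` hahn_neg mu).
Proof. by move=> mA; rewrite /= cjordan_negE /crestr0 mem_set. Qed.

Lemma positive_partBnegative mu A : measurable A ->
  mu A = positive_part mu A - negative_part mu A.
Proof.
move=> mA; rewrite {1}(jordan_decomp (hahn_decompositionP mu) mA).
by rewrite /cadd /= cscaleN1.
Qed.

Lemma ge0_negative_part mu A : (forall B, measurable B -> 0 <= mu B) ->
  measurable A -> negative_part mu A = 0.
Proof.
move=> mu0 mA; apply/eqP; rewrite eq_le measure_ge0 andbT.
by rewrite negative_partE// oppe_le0 mu0//; exact: measurableI.
Qed.

Lemma ge0_positive_part mu A : (forall B, measurable B -> 0 <= mu B) ->
  measurable A -> positive_part mu A = mu A.
Proof.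
move=> mu0 mA.
by rewrite [RHS]positive_partBnegative// ge0_negative_part// sube0.
Qed.

Lemma has_density_ge0 mu f A : has_density mu f -> measurable A -> 0 <= mu A.
Proof.
move=> [mf f0 muf] mA; rewrite muf//.
by apply: integral_ge0 => x _; rewrite lee_fin.
Qed.

Lemma has_density_dominates mu f : has_density mu f -> mu `<< nu.
Proof.
move=> [mf f0 muf]; apply/null_content_dominatesP => A mA nuA.
rewrite muf//; apply: null_set_integral => //; apply/measurable_EFinP.
exact: measurable_funTS.
Qed.

(** Change of variables through the Radon-Nikodym derivative treats nonnegative integrands. Since
    [f] is nonnegative, multiplication by it commutes with taking positive and negative parts, which
    gives the signed case. *)
Lemma integral_positive_part mu f (h : T -> R) : has_density mu f ->
  measurable_fun setT h ->
  \int[positive_part mu]_x (h x)%:E = \int[nu]_x (h x * f x)%:E.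
Proof.
move=> muf mh; have [mf f0 mufE] := muf.
have posE A : measurable A -> positive_part mu A = \int[nu]_(x in A) (f x)%:E.
  move=> mA; rewrite ge0_positive_part ?mufE// => B.
  exact: (has_density_ge0 muf).
have posnu : positive_part mu `<< nu.
  apply/null_content_dominatesP => A mA nuA; rewrite posE// -mufE//.
  by have /null_content_dominatesP -> := has_density_dominates muf.
pose g := Radon_Nikodym_SigmaFinite.f (positive_part mu) nu.
have gint : nu.-integrable setT g.
  exact: Radon_Nikodym_SigmaFinite.f_integrable.
have gf : ae_eq nu setT g (EFin \o f).
  apply: integral_ae_eq => //; first exact/measurable_EFinP.
  move=> A _ mA; rewrite -Radon_Nikodym_SigmaFinite.f_integral//.
  exact: posE.
have mg := measurable_int _ gint.
have chg (k : T -> R) : measurable_fun setT k -> (forall x, 0 <= k x)%R ->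
    \int[positive_part mu]_x (k x)%:E = \int[nu]_x (k x * f x)%:E.
  move=> mk k0.
  rewrite -(Radon_Nikodym_SigmaFinite.change_of_variables posnu)//; last first.
    exact/measurable_EFinP.
  apply: ae_eq_integral => //.
  - by apply: emeasurable_funM => //; exact/measurable_EFinP.
  - by apply/measurable_EFinP; exact: measurable_funM.
  - apply: filterS gf => x /(_ Logic.I) gfx _; rewrite EFinM.
    by congr (_ * _); exact: gfx.
have posM x : (Num.max (h x * f x) 0 = Num.max (h x) 0 * f x)%R.
  by rewrite maxr_pMl// mul0r.
have negM x : (Num.max (- (h x * f x)) 0 = Num.max (- h x) 0 * f x)%R.
  by rewrite maxr_pMl// mul0r mulNr.
rewrite integralE [RHS]integralE; congr (_ - _).
- under eq_integral do rewrite funeposE -EFin_max.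
  rewrite chg; last 2 first.
  + by apply: measurable_maxr => //; exact: measurable_cst.
  + by move=> x; rewrite le_max lexx orbT.
  by apply: eq_integral => x _; rewrite funeposE -EFin_max posM.
- under eq_integral do rewrite funenegE -EFinN -EFin_max.
  rewrite chg; last 2 first.
  + by apply: measurable_maxr => //; exact: measurableT_comp.
  + by move=> x; rewrite le_max lexx orbT.
  by apply: eq_integral => x _; rewrite funenegE -EFinN -EFin_max negM.
Qed.

Lemma charge_integral_density mu f (h : T -> R) : has_density mu f ->
  measurable_fun setT h -> charge_integral mu h = (\int[nu]_x (h x * f x))%R.
Proof.
move=> muf mh.
rewrite /charge_integral /Rintegral (integral_positive_part muf mh).
rewrite (eq_measure_integral mzero) ?integral_measure_zero ?subr0// => A mA _.
by apply: ge0_negative_part => // B; exact: (has_density_ge0 muf).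
Qed.

Lemma has_density_charge f : measurable_fun setT f -> (forall x, 0 <= f x)%R ->
  nu.-integrable setT (EFin \o f) -> exists mu, has_density mu f.
Proof. by move=> mf f0 fint; exists (induced_charge fint); split. Qed.

Hypotheses (hphi : divergence_function phi) (hslope : slope_pinfty phi = +oo).

Lemma slope_ninfty_divergence : slope_ninfty phi = -oo.
Proof.
apply/cvg_lim => //; apply: cvg_near_cst.
apply: filterS (nbhs_ninfty_lt (num_real 0%R)) => x x0.
by rewrite (divergence_lt0 hphi x0) mulyr ltr0_sg ?invr_lt0// mulN1e.
Qed.

Let integral_phi_ge0 (g : T -> R) : 0 <= \int[nu]_x phi (g x).
Proof. by apply: integral_ge0 => x _; exact: (divergence_ge0 hphi). Qed.

Let mphi (k : T -> R) : measurable_fun setT k ->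
  measurable_fun setT (fun x => phi (k x)).
Proof. by apply: measurableT_comp; exact: measurable_divergence. Qed.

(** Both slopes at infinity are infinite, so any singular mass would make the divergence infinite; a
    negative density would do the same, because [phi] is [+oo] on negative numbers. *)
Lemma divergence_ball_density tau mu :
  divergence_ball phi nu tau mu ->
  exists2 f, density_ball phi nu tau f & has_density mu f.
Proof.
move=> hmu; have : phi_divergence phi mu nu <= tau%:E by [].
rewrite /phi_divergence hslope slope_ninfty_divergence => hle.
have [acnu _ muE] :
    lebesgue_decomposition mu nu (ac_part mu nu, sing_part mu nu).
  rewrite /ac_part /sing_part -surjective_pairing.
  exact: svalP (cid (lebesgue_decomposition_exists mu nu)).
rewrite /= in acnu muE.
set s := sing_part mu nu in muE hle; set c := ac_part mu nu in acnu muE hle.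
have I0 := integral_phi_ge0 (fun x => fine (('d c '/d nu) x)).
have [p0 n0] : positive_part s setT = 0 /\ negative_part s setT = 0.
  have pge := measure_ge0 (positive_part s) setT.
  have nge := measure_ge0 (negative_part s) setT.
  have [p0|p0] := eqVneq (positive_part s setT) 0.
    have [//|n0] := eqVneq (negative_part s setT) 0.
    move: hle; rewrite p0 mul0e adde0 gt0_muleNy ?oppeK ?lt_def ?n0//.
    by rewrite addey ?leye_eq// gt_eqF// (lt_le_trans _ I0)// ltNy0.
  move: hle; rewrite gt0_muley ?lt_def ?p0// addey; last first.
    by rewrite gt_eqF// (lt_le_trans _ I0)// ltNy0.
  (* The sign is needed because the sum of [+oo] and [-oo] is [-oo] in [\bar R]. *)
  have : 0 <= - (negative_part s [set: T] * -oo).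
    by rewrite oppe_ge0 mule_ge0_le0// leNye.
  by case: (- _) => [r| |].
have s0 A : measurable A -> s A = 0.
  move=> mA; rewrite positive_partBnegative//.
  have -> : positive_part s A = 0.
    by apply/eqP; rewrite eq_le measure_ge0 andbT -p0 le_measure// inE.
  have -> : negative_part s A = 0; last by rewrite sube0.
  by apply/eqP; rewrite eq_le measure_ge0 andbT -n0 le_measure// inE.
move: hle; rewrite p0 n0 !mul0e adde0 sube0 => hle.
pose g := ('d c '/d nu).
have gint : nu.-integrable setT g by exact: Radon_Nikodym_integrable.
have gfin x : g x \is a fin_num by exact: Radon_Nikodym_fin_num.
have mg : measurable_fun setT (fine \o g).
  apply: measurableT_comp; first exact: fine_measurable.
  exact: measurable_int gint.
(* The derivative may be negative on a null set, while [density_ball] asks for nonnegativity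
   everywhere. *)
pose f x := Num.max (fine (g x)) 0%R.
have mf : measurable_fun setT f.
  by apply: measurable_maxr => //; exact: measurable_cst.
have phig : nu.-integrable setT (fun x => phi (fine (g x))).
  apply/integrableP; split; first exact: mphi mg.
  under eq_integral do rewrite gee0_abs ?(divergence_ge0 hphi)//.
  exact: le_lt_trans hle (ltry _).
have fg : \forall x \ae nu, f x = fine (g x).
  have := integrable_ae measurableT phig; apply: filterS => x /(_ Logic.I).
  rewrite /f; have [//|gx] := leP 0%R (fine (g x)).
  by rewrite (divergence_lt0 hphi gx).
exists f.
  split => //; first by move=> x; rewrite le_max lexx orbT.
  apply: le_trans hle; rewrite le_eqVlt; apply/orP; left; apply/eqP.
  apply: ge0_ae_eq_integral => //; [exact: mphi|exact: mphi mg|..].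
  - by move=> x _; exact: (divergence_ge0 hphi).
  - by move=> x _; exact: (divergence_ge0 hphi).
  - by apply: filterS fg => x ->.
split => //; first by move=> x; rewrite le_max lexx orbT.
move=> A mA; rewrite muE// s0// adde0 (Radon_Nikodym_integral acnu mA).
have gE : 'd c '/d nu = EFin \o (fine \o g).
  by apply/funext => x /=; rewrite fineK.
apply: ae_eq_integral => //.
- by apply: measurable_funTS; exact: measurable_int gint.
- by apply/measurable_EFinP; exact: measurable_funTS.
- by rewrite gE; apply: filterS fg => x fgx _; rewrite /= fgx.
Qed.

Lemma density_divergence_ball tau mu f : density_ball phi nu tau f ->
  has_density mu f -> divergence_ball phi nu tau mu.
Proof.
move=> [mf f0 ftau] muf; have [_ _ mufE] := muf.
have munu := has_density_dominates muf.
suff: phi_divergence phi mu nu <= tau%:E by [].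
rewrite /phi_divergence; have [acnu [N [mN nuN sN]] muE] :
    lebesgue_decomposition mu nu (ac_part mu nu, sing_part mu nu).
  rewrite /ac_part /sing_part -surjective_pairing.
  exact: svalP (cid (lebesgue_decomposition_exists mu nu)).
rewrite /= in acnu sN muE.
set s := sing_part mu nu in sN muE *; set c := ac_part mu nu in acnu muE *.
(* The decomposition is a chosen witness, so its uniqueness is reproved in this case: off [N] the
   singular part vanishes, and inside the null set [N] both [mu] and [c] vanish, hence so does their
   difference [s]. *)
have null A : measurable A -> s A = 0.
  move=> mA; rewrite (chargeDI s mA mN).
  have mAN : measurable (A `&` N) by exact: measurableI.
  have nuAN : nu (A `&` N) = 0.
    by apply/eqP; rewrite eq_le measure_ge0 andbT -nuN le_measure// inE.
  have -> : s (A `\` N) = 0 by apply: sN; [exact: measurableD|move=> x []].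
  have := muE _ mAN.
  have /null_content_dominatesP/(_ _ mAN nuAN) -> := munu.
  have /null_content_dominatesP/(_ _ mAN nuAN) -> := acnu.
  by rewrite !add0e => <-.
have mP := measurable_hahn_pos s; have mN' := measurable_hahn_neg s.
have -> : positive_part s setT = 0.
  by rewrite positive_partE// null//; exact: measurableI.
have -> : negative_part s setT = 0.
  by rewrite negative_partE// null ?oppe0//; exact: measurableI.
rewrite !mul0e adde0 sube0; apply: le_trans ftau.
pose g := ('d c '/d nu).
have gint : nu.-integrable setT g by exact: Radon_Nikodym_integrable.
have gf : ae_eq nu setT g (EFin \o f).
  apply: integral_ae_eq => //; first exact/measurable_EFinP.
  move=> A _ mA.
  by rewrite -Radon_Nikodym_integral// -mufE// muE// null// adde0.
rewrite le_eqVlt; apply/orP; left; apply/eqP.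
apply: ge0_ae_eq_integral => //; [|exact: mphi|..].
- apply: mphi; apply: (@measurableT_comp _ _ _ _ _ _ fine _ g).
    exact: fine_measurable.
  exact: measurable_int gint.
- by move=> x _; exact: (divergence_ge0 hphi).
- by move=> x _; exact: (divergence_ge0 hphi).
- apply: filterS gf => x /(_ Logic.I) gfx _.
  by rewrite (_ : 'd c '/d nu x = (f x)%:E).
Qed.

End charge_density.

(** * Convergence of ultrafilters in the initial topology and compactness *)

Lemma cvg_initial_topology (S : choiceType) (U : topologicalType) (f : S -> U)
    (F : set_system S) (s : S) : Filter F -> f x @[x --> F] --> f s ->
  F --> (s : initial_topology f).
Proof.
move=> FF fs V; rewrite nbhsE => -[B [[W oW <-] Ws] BV].
apply: filterS BV _; apply: fs; exact: open_nbhs_nbhs.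
Qed.

Section divergence_ball_compact.
Context (R : realType) d (T : measurableType d).
Context (phi : R -> \bar R) (nu : {finite_measure set T -> \bar R}) (tau : R).
Hypotheses (hphi : divergence_function phi) (hslope : slope_pinfty phi = +oo).

(** The clause on masses of sets is kept for the probability case, where positivity and total mass
    have to be read off the limit. *)
Lemma ultrafilter_divergence_ball (F : set_system ({charge set T -> \bar R})) :
  UltraFilter F -> F (divergence_ball phi nu tau) ->
  exists mu, [/\ divergence_ball phi nu tau mu,
    F --> (mu : subexponential_topology phi nu) &
    forall A, measurable A ->
      0 <= mu A /\
      (fun m : ({charge set T -> \bar R}) => fine (m A)) @ F --> fine (mu A)].
Proof.
move=> FU FB; have FP : ProperFilter F := @ultra_proper _ _ FU.
have [m0 m0B] := filter_ex FB.
have [f0 f0ball _] := divergence_ball_density hphi hslope m0B.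
(* The family is indexed by all charges, as [F] lives on them; outside the ball the fixed density
   [f0] fills in, invisibly to [F], which contains the ball. *)
have /choice[f_ hf_] : forall m : ({charge set T -> \bar R}), exists f,
    density_ball phi nu tau f /\
    (divergence_ball phi nu tau m -> has_density nu m f).
  move=> m; have [/(divergence_ball_density hphi hslope)[f ? ?]|nB] :=
    pselect (divergence_ball phi nu tau m); first by exists f.
  by exists f0.
have f_ball m : density_ball phi nu tau (f_ m) by have [] := hf_ m.
have [f [mf fge0 fint fcvg]] := ultrafilter_limit_density hphi hslope FU f_ball.
have fball := density_ball_closed hphi hslope FP f_ball mf fge0 fint fcvg.
have [mu muf] := has_density_charge mf fge0 fint.
exists mu; split.
- exact: (density_divergence_ball hphi fball muf).
- apply/cvg_sup => -[g gsub].
  apply: cvg_initial_topology => /=.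
  have mg : measurable_fun setT (g : T -> R) by exact: measurable_funPT.
  have gy : young_integrable phi nu g.
    by split => // t; exact: strongly_subexponential_young.
  rewrite (charge_integral_density muf mg).
  have := young_integrable_cvg hphi hslope FP f_ball fball fcvg gy.
  apply: cvg_trans; apply: near_eq_cvg.
  apply: filterS FB => m mB.
  by rewrite (charge_integral_density ((hf_ m).2 mB) mg).
- move=> A mA; split; first exact: has_density_ge0 muf mA.
  have [_ _ ->//] := muf; have := fcvg A mA.
  apply: cvg_trans; apply: near_eq_cvg.
  by apply: filterS FB => m mB; have [_ _ ->] := (hf_ m).2 mB.
Qed.

End divergence_ball_compact.

Theorem corollary5p3p5 (R : realType) (d : measure_display)
    (T : measurableType d) (phi : R -> \bar R) (nu : probability T R)
    (hT : exists A : set T, [/\ measurable A, A <> set0 & A <> [set: T]])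
    (hphi : divergence_function phi)
    (hphi_pinfty : slope_pinfty phi = +oo)
    (tau : R) :
  compact (divergence_ball phi nu tau
           : set (subexponential_topology phi nu)) /\
  compact (probability_charges T R `&` divergence_ball phi nu tau
           : set (subexponential_topology phi nu)).
Proof.
rewrite compact_ultra; split => F FU FB.
  have [mu [muB Fmu _]] := ultrafilter_divergence_ball hphi hphi_pinfty FU FB.
  by exists mu.
have [FP FB'] : F (probability_charges T R) /\ F (divergence_ball phi nu tau).
  by split; apply: filterS FB => m [].
have [mu [muB Fmu muA]] := ultrafilter_divergence_ball hphi hphi_pinfty FU FB'.
exists mu; split => //; split => //; split.
  by move=> A /muA[].
(* Along [F] the total mass is eventually equal to 1, so its limit, the total mass of [mu], is 1. *)
have [_ muT] := muA setT measurableT.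
have mufin : mu setT \is a fin_num by exact: fin_num_measure.
rewrite -(fineK mufin); congr EFin.
apply: (cvg_unique _ muT) => //.
apply: cvg_near_cst; apply: filterS FP => m [_ ->].
by [].
Qed.
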